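(* Let $h\ge 1$ be an integer and let $\varphi(x_1,\ldots,x_h)=\sum_{i=1}^h c_i x_i$ be a linear form with integer coefficients $c_1,\ldots,c_h$ that satisfies condition $N$. Let $B=\{b_k : k=1,2,3,\ldots\}$ be a set of integers. Then there exists an infinite $\varphi$-Sidon set $A=\{a_k : k=1,2,3,\ldots\}$ of integers such that $|a_k-b_k|<k^{4h}$ holds for all positive integers $k$.
   Context: Condition $N$: for $I\subseteq\{1,\ldots,h\}$ put $s_I=\sum_{i\in I}c_i$, with $s_\emptyset=0$. The linear form $\varphi=\sum_{i=1}^h c_ix_i$ satisfies condition $N$ if there do not exist disjoint subsets $I_1,I_2$ of $\{1,\ldots,h\}$, not both empty, with $s_{I_1}=s_{I_2}$. $\varphi$-Sidon set: a nonempty set $A$ of integers is a $\varphi$-Sidon set if for all $h$-tuples $(a_1,\ldots,a_h)\in A^h$ and $(a_1',\ldots,a_h')\in A^h$, $\varphi(a_1,\ldots,a_h)=\varphi(a_1',\ldots,a_h')$ implies $(a_1,\ldots,a_h)=(a_1',\ldots,a_h')$. Notation such as $A=\{a_k : k=1,2,3,\ldots\}$ denotes an enumeration of an infinite set by pairwise distinct elements (in no particular order). *)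

(* Defs.v *)
From mathcomp Require Import all_boot all_order all_algebra.
From mathcomp Require Import boolp classical_sets functions cardinality.

Set Implicit Arguments.
Unset Strict Implicit.
Unset Printing Implicit Defensive.

Import Order.TTheory GRing.Theory Num.Theory.
Local Open Scope ring_scope.

(* The coefficients c_1, ..., c_h are indexed from 0 by 'I_h. *)
Definition linear_form (h : nat) (c : 'I_h -> int)
    (x : {ffun 'I_h -> int}) : int :=
  \sum_(i < h) c i * x i.

Definition subset_sum (h : nat) (c : 'I_h -> int) (I : {set 'I_h}) : int :=
  \sum_(i in I) c i.

(* [finset.set0] is qualified because [classical_sets] shadows it. *)
Definition condition_N (h : nat) (c : 'I_h -> int) : Prop :=
  ~ exists I1 I2 : {set 'I_h},
      [/\ [disjoint I1 & I2],
          ~ (I1 = finset.set0 /\ I2 = finset.set0) &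
          subset_sum c I1 = subset_sum c I2].

Local Open Scope classical_set_scope.

Definition phi_Sidon (h : nat) (c : 'I_h -> int) (A : set int) : Prop :=
  A !=set0 /\
  forall x y : {ffun 'I_h -> int},
    (forall i, A (x i)) -> (forall i, A (y i)) ->
    linear_form c x = linear_form c y -> x = y.

(* A = {a_k : k = 1, 2, 3, ...} with pairwise distinct a_k, in no particular
   order; the value [a 0] is irrelevant. *)
Definition enumeration (A : set int) (a : nat -> int) : Prop :=
  set_bij [set k : nat | (0 < k)%N] A a.

(* Main.v *)
(* Greedy choice: given a_1, ..., a_(k-1), a value t for a_k is bad if two tuples
   over {a_1, ..., a_(k-1), t} have equal images under phi but contain t at
   different sets of places I and J. Such a collision is a linear equation in t
   with leading coefficient s_I - s_J, nonzero by condition N, so there are fewer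
   than k^(2h) bad values and one of b_k, ..., b_k + k^(2h) - 1 is good. Tuples
   containing t at the same places are handled by replacing t by a_1. *)
Require Import Defs.
From mathcomp Require Import all_boot all_order all_algebra.
From mathcomp Require Import boolp classical_sets functions cardinality.
From mathcomp Require Import ring zify.

Set Implicit Arguments.
Unset Strict Implicit.

Import Order.TTheory GRing.Theory Num.Theory.
Local Open Scope classical_set_scope.
Local Open Scope ring_scope.

Definition update (a : nat -> int) (n : nat) (t : int) (k : nat) : int :=
  if k == n then t else a k.

(** Tuples are given by indices into [a] rather than by values, so that injectivity of
    [comp_form c a] yields both the Sidon property and the distinctness of the terms. *)
Definition comp_form (h : nat) (c : 'I_h -> int) (a : nat -> int)
    (p : 'I_h -> nat) : int :=
  linear_form c [ffun i => a (p i)].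

Definition fiber (h : nat) (p : 'I_h -> nat) (n : nat) : {set 'I_h} :=
  [set i | p i == n]%SET.

(** The negation of bad: a collision need only agree on the places of the new term, since its
    remaining places are settled by induction. *)
Definition fresh (h : nat) (c : 'I_h -> int) (a : nat -> int) (n : nat)
    (t : int) : Prop :=
  forall p q : 'I_h -> nat,
    (forall i, p i <= n)%N -> (forall i, q i <= n)%N ->
    comp_form c (update a n t) p = comp_form c (update a n t) q ->
    fiber p n = fiber q n.

(** Cancelling the common part of [I] and [J] leaves two disjoint sets with equal sums, both empty
    only if [I = J]. *)
Lemma condition_N_inj (h : nat) (c : 'I_h -> int) :
  condition_N c -> injective (subset_sum c).
Proof.
move=> cN I J sIJ; apply: contrapT => neIJ; apply: cN.
exists (I :\: J)%SET, (J :\: I)%SET; split.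
- rewrite -setI_eq0; apply/eqP/setP=> i; rewrite !inE.
  by case: (i \in I); case: (i \in J).
- case=> /setP IJ /setP JI; apply: neIJ; apply/setP=> i.
  by have := IJ i; have := JI i; rewrite !inE; case: (i \in I); case: (i \in J).
- move: sIJ; rewrite /subset_sum (big_setID J) /= [in RHS](big_setID I) /=.
  by rewrite finset.setIC => /addrI.
Qed.

Lemma eq_comp_form (h : nat) (c : 'I_h -> int) (a a' : nat -> int)
    (p p' : 'I_h -> nat) :
  (forall i, a (p i) = a' (p' i)) -> comp_form c a p = comp_form c a' p'.
Proof. by move=> E; apply: eq_bigr => i _; rewrite !ffunE E. Qed.

Lemma comp_form_update (h : nat) (c : 'I_h -> int) (a : nat -> int) (n : nat)
    (t : int) (p : 'I_h -> nat) :
  comp_form c (update a n t) p =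
    comp_form c (update a n 0) p + subset_sum c (fiber p n) * t.
Proof.
rewrite /comp_form /linear_form /subset_sum mulr_suml [X in _ + X]big_mkcond.
rewrite -big_split; apply: eq_bigr => i _ /=; rewrite !ffunE inE /update.
by case: eqP => _; rewrite ?mulr0 ?add0r ?addr0.
Qed.

Lemma comp_form_update_id (h : nat) (c : 'I_h -> int) (a : nat -> int) (n : nat)
    (p : 'I_h -> nat) :
  comp_form c (update a n (a n)) p = comp_form c a p.
Proof. by apply: eq_comp_form => i; rewrite /update; case: eqP => [->|]. Qed.

(* A collision between p and q is a linear equation in t, whose leading
   coefficient s_I - s_J is nonzero by condition N. *)
Lemma collision_unique (h : nat) (c : 'I_h -> int) (a : nat -> int) (n : nat)
    (p q : 'I_h -> nat) (t t' : int) :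
  condition_N c -> fiber p n <> fiber q n ->
  comp_form c (update a n t) p = comp_form c (update a n t) q ->
  comp_form c (update a n t') p = comp_form c (update a n t') q -> t = t'.
Proof.
move=> cN nepq.
rewrite !(comp_form_update _ _ _ t) !(comp_form_update _ _ _ t').
move=> Et Et'; apply/eqP; rewrite -subr_eq0.
have /eqP : (subset_sum c (fiber p n) - subset_sum c (fiber q n)) * (t - t') = 0.
  by lia.
rewrite mulf_eq0 => /orP [/eqP /subr0_eq sE|//].
by have := condition_N_inj cN sE.
Qed.

Lemma fresh_exists (h : nat) (c : 'I_h -> int) (a : nat -> int) (n N : nat)
    (b : int) :
  condition_N c -> ((n.+1 ^ (2 * h)) <= N)%N ->
  exists j : nat, (j < N)%N /\ fresh c a n (b + j%:Z).
Proof.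
move=> cN leN; apply: contrapT => noj.
pose T := ({ffun 'I_h -> 'I_n.+1} * {ffun 'I_h -> 'I_n.+1})%type.
pose f (w : {ffun 'I_h -> 'I_n.+1}) (i : 'I_h) : nat := w i.
(* If every candidate is bad, each [j] is charged to a colliding pair of index maps; there are only
   [n.+1 ^ (2 * h)] pairs, and none is charged twice. *)
have collide (j : 'I_N) : exists w : T, fiber (f w.1) n <> fiber (f w.2) n /\
    comp_form c (update a n (b + j%:Z)) (f w.1) =
    comp_form c (update a n (b + j%:Z)) (f w.2).
  apply: contrapT => now; apply: noj; exists j; split=> // p q pn qn Epq.
  apply: contrapT => nepq; apply: now.
  exists ([ffun i => inord (p i)], [ffun i => inord (q i)]) => /=.
  have fE r : (forall i, r i <= n)%N -> f [ffun i => inord (r i)] = r.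
    by move=> rn; apply/funext=> i; rewrite /f ffunE inordK // ltnS.
  by rewrite !fE.
have [w wP] := boolp.choice collide.
have w_inj : injective w.
  move=> i j Eij; have [ne Ei] := wP i; have [_ Ej] := wP j.
  rewrite -Eij in Ej.
  have /addrI [] := collision_unique cN ne Ei Ej.
  exact: val_inj.
pose d : {ffun 'I_h -> 'I_n.+1} := [ffun=> ord0].
(* The diagonal is not a collision, which makes the count strict. *)
have /proper_card : (w @: [set: 'I_N])%SET \proper [set: T]%SET.
  apply/properP; split; first exact: finset.subsetT.
  exists (d, d); first by rewrite inE.
  apply/imsetP=> -[j _ E]; have [+ _] := wP j.
  by rewrite -E; apply.
rewrite card_imset // !cardsT card_ord card_prod card_ffun !card_ord.
by rewrite -expnD addnn -mul2n ltnNge leN.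
Qed.

Lemma fresh_sequence (h : nat) (c : 'I_h -> int) (b : nat -> int) :
  condition_N c ->
  exists a : nat -> int, forall n,
    [/\ fresh c a n (a n), b n <= a n &
        a n < b n + (n.+1 ^ (2 * h))%N%:Z].
Proof.
move=> cN.
have step_ex (x : (nat -> int) * nat) : exists t, [/\ fresh c x.1 x.2 t,
    b x.2 <= t & t < b x.2 + (x.2.+1 ^ (2 * h))%N%:Z].
  have [j [jN jP]] := fresh_exists x.1 (b x.2) cN (leqnn (x.2.+1 ^ (2 * h))).
  by exists (b x.2 + j%:Z); split=> //; lia.
have [step stepP] := boolp.choice step_ex.
(* [g n] holds the first [n] terms and is 0 elsewhere; the zeros are harmless because freshness at
   [n] overwrites index [n] and reads no later one. *)
pose g := fix g n := if n is m.+1 then update (g m) m (step (g m, m))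
                     else fun=> 0.
pose a n := step (g n, n).
have ga n k : (k < n)%N -> g n k = a k.
  elim: n => // n IH; rewrite ltnS leq_eqVlt /= /update.
  by case: eqP => [-> //|_] /= /IH.
exists a => n; have [fr lo hi] := stepP (g n, n); split=> // p q pn qn Epq.
apply: fr => //=.
have E r : (forall i, r i <= n)%N -> comp_form c (update (g n) n (a n)) r =
                                     comp_form c (update a n (a n)) r.
  move=> rn; apply: eq_comp_form => i; rewrite /update.
  by case: eqP => // /eqP ne; rewrite ga // ltn_neqAle ne rn.
by rewrite !E.
Qed.

(** Induction on a bound for the indices: the largest index occupies the same places in both tuples,
    so replacing it by 0 shifts both values equally and lowers the bound. *)
Lemma fresh_comp_form_inj (h : nat) (c : 'I_h -> int) (a : nat -> int) :
  (forall n, fresh c a n (a n)) -> injective (comp_form c a).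
Proof.
move=> fr.
suff bounded n p q : (forall i, p i < n)%N -> (forall i, q i < n)%N ->
    comp_form c a p = comp_form c a q -> p = q.
  move=> p q; apply: (bounded (\max_i maxn (p i) (q i)).+1) => i;
    rewrite ltnS; apply: leq_trans (leq_bigmax i); lia.
elim: n p q => [|n IH] p q pn qn Epq.
  by apply/funext => i; have := pn i.
have fib i : (p i == n) = (q i == n).
  have /setP /(_ i) : fiber p n = fiber q n.
    by apply: (fr n) => //; rewrite !comp_form_update_id.
  by rewrite !inE.
(* When [n] is 0 there is no smaller index to substitute, but then all indices are 0. *)
case: (posnP n) => [n0|n_gt0].
  by apply/funext => i; have := pn i; have := qn i; lia.
pose lower (r : 'I_h -> nat) i := if r i == n then 0%N else r i.
have lower_lt r : (forall i, r i < n.+1)%N -> forall i, (lower r i < n)%N.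
  by move=> rn i; have := rn i; rewrite /lower; case: eqP => //; lia.
have lowerE : lower p = lower q.
  apply: IH; [exact: lower_lt|exact: lower_lt|].
  have Elow r : fiber r n = fiber p n -> comp_form c a (lower r) =
      comp_form c a r + subset_sum c (fiber p n) * (a 0%N - a n).
    move=> <-; rewrite (@eq_comp_form _ _ a (update a n (a 0%N)) _ r).
      rewrite comp_form_update -(comp_form_update_id c a n r).
      by rewrite (comp_form_update c a n (a n)); ring.
    by move=> i; rewrite /lower /update; case: eqP.
  by rewrite !Elow ?Epq //; apply/setP => i; rewrite !inE fib.
apply/funext => i; have := congr1 (@^~ i) lowerE; rewrite /lower.
by have := fib i; case: (p i =P n) => [-> /esym/eqP ->|_ <-].
Qed.

Theorem theorem1p1 (h : nat) (h_ge1 : (1 <= h)%N) (c : 'I_h -> int)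
    (cN : condition_N c) (B : set int) (b : nat -> int)
    (Bb : enumeration B b) :
  exists (A : set int) (a : nat -> int),
    [/\ infinite_set A,
        phi_Sidon c A,
        enumeration A a &
        forall k : nat, (0 < k)%N -> `|a k - b k| < k%:Z ^+ (4 * h)%N].
Proof.
(* The construction counts from 0, so its term [n] approximates [b n.+1]. *)
have [a aP] := fresh_sequence (fun n => b n.+1) cN.
have form_inj : injective (comp_form c a).
  by apply: fresh_comp_form_inj => n; have [] := aP n.
have a_inj : injective a.
  (* Equal terms give colliding constant tuples, which can be compared at a place because [h] is
     positive. *)
  move=> k l Ekl; have : comp_form c a (fun=> k) = comp_form c a (fun=> l).
    exact: eq_comp_form.
  by move=> /form_inj /(congr1 (@^~ (Ordinal h_ge1))).
exists (range a), (fun k => a k.-1); split.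
- move=> /(finite_preimage (in2W a_inj)).
  by rewrite preimage_range; exact: infinite_nat.
- split; first by exists (a 0%N), 0%N.
  have index (z : {ffun 'I_h -> int}) : (forall i, range a (z i)) ->
      exists p : 'I_h -> nat, z = [ffun i => a (p i)].
    move=> zA; have /boolp.choice [p pz] i : exists n, a n = z i.
      by have [n _] := zA i; exists n.
    by exists p; apply/ffunP => i; rewrite ffunE pz.
  by move=> x y /index [p ->] /index [q ->] /form_inj ->.
- split.
  + by move=> k _; exists k.-1.
  + by move=> [|k] [|l]; rewrite !inE //= => _ _ /a_inj ->.
  + by move=> _ [n _ <-]; exists n.+1.
- case=> // n _ /=; have [_ lo hi] := aP n.
  (* The distance is already below the power [2 * h] of [n.+1]; the exponent is then weakened to
     [4 * h]. *)
  rewrite -(natz n.+1) -natrX natz ger0_norm ?subr_ge0 // ltrBlDl.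
  rewrite (lt_le_trans hi) // lerD2l lez_nat leq_pexp2l //.
  by lia.
Qed.
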